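(* For $s \in \mathbb{R}$ and $\omega = (\omega_1,\ldots,\omega_n) \in \Omega_{\kappa,n}$ put $$g_{n,s}(\omega) = \frac{1}{n} \sum_{i = 1}^n \mathbf{1}_{(-\infty, s]}(\omega_i), \qquad f(\omega) := \sup_{s \in \mathbb{R}} \big(g_{n,s}(\omega) - \mathbb{E}_{\kappa,n} g_{n,s}\big).$$ Then for any $t \ge 0$, $$\mathbb{P}_{\kappa,n}\big( \sqrt{n}\,|f - \mathbb{E}_{\kappa,n} f| \ge t\big) \le 2\exp\Big( - \frac{t^2}{4\big( 1 - \frac{n}{N} \big)} \Big).$$
   Context: Let $L \ge 2$ be an integer, $\kappa = (\kappa_1,\ldots,\kappa_L)$ a vector of positive integers, $N = \kappa_1 + \cdots + \kappa_L$, and $\mathcal{X} = \{x_1,\ldots,x_L\} \subset \mathbb{R}$ a set of $L$ distinct reals. The multislice is $\Omega_\kappa = \{\omega \in \mathcal{X}^N : \#\{i : \omega_i = x_\ell\} = \kappa_\ell \text{ for } \ell = 1,\ldots,L\}$, with uniform distribution $\mathbb{P}_\kappa$. For $1 \le n \le N$ let $pr_n$ be the projection onto the first $n$ coordinates, $\Omega_{\kappa,n} := pr_n(\Omega_\kappa)$, and let $\mathbb{P}_{\kappa,n}$ be the push-forward of $\mathbb{P}_\kappa$ under $pr_n$, with expectation $\mathbb{E}_{\kappa,n}$. If $n = N$, the exponential on the right-hand side is read as $0$ for $t > 0$ and as $1$ for $t = 0$. *)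

(* Defs.v *)
From HB Require Import structures.
From mathcomp Require Import all_boot all_order all_algebra.
From mathcomp Require Import boolp classical_sets functions reals numfun sequences exp.

Set Implicit Arguments.
Unset Strict Implicit.
Unset Printing Implicit Defensive.

Import Order.TTheory GRing.Theory Num.Theory.
Local Open Scope ring_scope.

Section Multislice.
Variables (R : realType) (L : nat) (kappa : 'I_L -> nat) (x : 'I_L -> R).

Definition dimN : nat := (\sum_(l < L) kappa l)%N.

(* The finite type of the reals of the form [x l]; [val] is its inclusion
   into [R]. *)
Definition alphabet : finType := seq_sub (codom x).

Definition multislice : {set {ffun 'I_dimN -> alphabet}} :=
  [set w : {ffun 'I_dimN -> alphabet} |
    [forall l : 'I_L, #|[set i | val (w i) == x l]| == kappa l]]%SET.

Definition prob_kappa (A : {set {ffun 'I_dimN -> alphabet}}) : R :=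
  #|multislice :&: A|%:R / #|multislice|%:R.

Variables (n : nat) (le_nN : (n <= dimN)%N).

Definition proj (w : {ffun 'I_dimN -> alphabet}) : {ffun 'I_n -> alphabet} :=
  [ffun i => w (widen_ord le_nN i)].

Definition multislice_n : {set {ffun 'I_n -> alphabet}} :=
  (proj @: multislice)%SET.

Definition prob_kappa_n (A : {set {ffun 'I_n -> alphabet}}) : R :=
  prob_kappa (proj @^-1: A)%SET.

Definition expect_kappa_n (h : {ffun 'I_n -> alphabet} -> R) : R :=
  \sum_(w in multislice_n) h w * prob_kappa_n [set w]%SET.

Definition empirical_cdf (s : R) (w : {ffun 'I_n -> alphabet}) : R :=
  n%:R^-1 * \sum_(i < n) \1_(`]-oo, s]%classic) (val (w i)).

(* [sup] is total, with value 0 on sets that are empty or unbounded above; the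
   set here is nonempty and bounded, so this is the true supremum. *)
Definition sup_deviation (w : {ffun 'I_n -> alphabet}) : R :=
  sup (range (fun s : R => empirical_cdf s w - expect_kappa_n (empirical_cdf s))).

End Multislice.

(* For n = N the denominator vanishes, and MathComp's [y / 0 = 0] would turn
   the exponential into 1 for every t; the limiting values are imposed. *)
Definition exp_tail (R : realType) (n N : nat) (t : R) : R :=
  if n == N then (if t == 0 then 1 else 0)
  else expR (- (t ^+ 2 / (4 * (1 - n%:R / N%:R)))).

(* Main.v *)
Require Import Defs.
From mathcomp Require Import all_boot all_order all_algebra perm.
From mathcomp Require Import boolp classical_sets functions reals numfun sequences exp.
From mathcomp Require Import topology normedtype derive realfun.
From mathcomp Require Import ring lra zify.

Set Implicit Arguments.
Unset Strict Implicit.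
Unset Printing Implicit Defensive.

Import Order.TTheory GRing.Theory Num.Theory.
Import numFieldNormedType.Exports.
Local Open Scope ring_scope.

(** Write N = n + d. The statistic f of a word only depends on which letters
    fall in the first n positions, so for a fixed word w0 of the multislice it
    becomes a function h of an n-subset A of the N positions: the supremum
    deviation of the empirical distribution of w0 over A. Permuting the
    positions shows that f of a uniform word has the law of h of a uniform
    n-subset ([avg_word_slice]); everything else takes place on n-subsets.

    Exchanging one element of A for another moves h by at most 1/n
    ([slice_deviation_lip]). Reveal A one element at a time and consider the
    martingale of conditional means of h. When k further elements, besides the
    one being revealed, are still to come, the choices a and b for the revealed
    element are coupled by applying the transposition (a b) to A; this changes
    A only if the other element stays outside A, an event of probability
    d / (k + d). So the increments are bounded by (1/n) d / (k + d)
    ([avg_extensions_dist]). The factor d / (k + d), close to d / N at the start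
    of the sampling, is the source of the 1 - n/N of the theorem.

    A centred variable of oscillation r has moment generating function at most
    exp(r^2/2) ([avg_expR_le]). For a function that moves by at most c under an
    exchange, the exponents of the last k steps add up to at most
    c^2 k d / (k + d) ([variance_step], [mgf_extensions]). Multiplying h by l
    makes c = l/n, and Markov's inequality with the optimal l gives exactly
    exp(- t^2 / (4 (1 - n/N))) for each of the two tails ([slice_tail]). When
    n = N there is a single n-subset, so h - E h = 0. *)

(** * An exponential moment bound on finite averages *)

Lemma ndecr_of_deriv (R : realType) (f df : R -> R) :
  (forall x : R, is_derive x (1 : R) f (df x)) ->
  (forall x : R, 0 < x -> 0 <= df x) ->
  forall x : R, 0 <= x -> f 0 <= f x.
Proof.
move=> fdf df_ge0 x x_ge0.
apply: (@ger0_derive1_ndecry R f 0) => //.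
- by move=> y; rewrite in_itv/= andbT => /df_ge0; rewrite derive1E derive_val.
- apply: continuous_subspaceT => y; apply: differentiable_continuous.
  by apply/derivable1_diffP; have [] := fdf y.
Qed.

(** For x >= 0 the function exp(y - y^2/2) + exp(- y - y^2/2) decreases from its
    value 2 at 0: its derivative has the sign of (1 - y) e^y - (1 + y) e^-y,
    which vanishes at 0 and has derivative - y (e^y - e^-y) <= 0. *)
Lemma coshR_le (R : realType) (x : R) :
  expR x + expR (- x) <= 2 * expR (x ^+ 2 / 2).
Proof.
wlog x_ge0 : x / 0 <= x.
  move=> W; have [/W//|/ltW x_le0] := leP 0 x.
  by have := W (- x); rewrite sqrrN opprK addrC oppr_ge0; apply.
pose p (y : R) := (1 + y) * expR (- y) - (1 - y) * expR y.
have p_ge0 y : 0 <= y -> 0 <= p y.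
  move=> y_ge0; have -> : 0 = p 0 by rewrite /p oppr0 expR0; ring.
  apply: (@ndecr_of_deriv R p (fun y => y * (expR y - expR (- y))))
    => // [z|z z0].
    by rewrite /p; apply: is_derive_eq; rewrite /GRing.scale/=; ring.
  by apply: mulr_ge0; [exact: ltW | rewrite subr_ge0 ler_expR; lra].
pose q (y : R) := - (expR (y - y ^+ 2 / 2) + expR (- y - y ^+ 2 / 2)).
have : q 0 <= q x.
  apply: (@ndecr_of_deriv R q (fun y => expR (- (y ^+ 2 / 2)) * p y))
    => // [z|z z0].
    by rewrite /q /p; apply: is_derive_eq; rewrite /GRing.scale/= !expRD; field.
  by apply: mulr_ge0; [exact: expR_ge0 | exact: p_ge0 (ltW z0)].
rewrite /q oppr0 expr0n/= mul0r subr0 expR0 !expRD -mulrDl.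
by rewrite (expRN (x ^+ 2 / 2)) lerN2 ler_pdivrMr ?expR_gt0 ?mul1r; lra.
Qed.

Definition avg (R : realType) (T : finType) (S : {set T}) (h : T -> R) : R :=
  (\sum_(x in S) h x) / #|S|%:R.

Lemma avg_set1 (R : realType) (T : finType) (z : T) (h : T -> R) :
  avg [set z]%SET h = h z.
Proof. by rewrite /avg big_set1 cards1 divr1. Qed.

Section Average.
Variables (R : realType) (T : finType) (S : {set T}).
Implicit Types h : T -> R.

Lemma avgMl c h : avg S (fun x => c * h x) = c * avg S h.
Proof. by rewrite /avg -mulr_sumr mulrA. Qed.

Lemma le_avg h g : {in S, forall x, h x <= g x} -> avg S h <= avg S g.
Proof. by move=> hg; rewrite ler_wpM2r ?invr_ge0// ler_sum. Qed.

Lemma eq_avg h g : {in S, h =1 g} -> avg S h = avg S g.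
Proof. by move=> hg; rewrite /avg (eq_bigr _ hg). Qed.

Lemma avgB_cst c h : (0 < #|S|)%N -> avg S (fun x => h x - c) = avg S h - c.
Proof.
move=> S0; have S_neq0 : #|S|%:R != 0 :> R by rewrite pnatr_eq0 -lt0n.
by rewrite /avg sumrB sumr_const -mulr_natr; field.
Qed.

(** Hoeffding's lemma by symmetrization. By Jensen's inequality, multiplying by
    the average of exp(- y b) only increases the left-hand side; what results is
    the average over pairs of exp(y a - y b), that is, of cosh(y a - y b). *)
Lemma avg_expR_le (y : T -> R) (r : R) :
  {in S &, forall a b, `|y a - y b| <= r} -> avg S y = 0 ->
  avg S (expR \o y) <= expR (r ^+ 2 / 2).
Proof.
move=> y_osc y0; have [S0|S0] := posnP #|S|.
  by rewrite /avg S0 invr0 mulr0 expR_ge0.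
have S_gt0 : 0 < #|S|%:R :> R by rewrite ltr0n.
have jensen : #|S|%:R <= \sum_(b in S) expR (- y b).
  have -> : #|S|%:R = \sum_(b in S) (1 + - y b).
    have /eqP := y0; rewrite mulf_eq0 invr_eq0 (gt_eqF S_gt0) orbF => /eqP ys0.
    by rewrite big_split/= sumrN ys0 sumr_const subr0.
  by apply: ler_sum => b _; exact: expR_ge1Dx.
rewrite /avg ler_pdivrMr// -(ler_pM2r S_gt0).
pose D := \sum_(a in S) \sum_(b in S) expR (y a - y b).
have le_D : (\sum_(a in S) (expR \o y) a) * #|S|%:R <= D.
  rewrite /D mulr_suml ler_sum// => a aS.
  under eq_bigr do rewrite expRD.
  by rewrite -mulr_sumr ler_wpM2l ?expR_ge0.
have symD : D + D = \sum_(a in S) \sum_(b in S)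
    (expR (y a - y b) + expR (- (y a - y b))).
  rewrite {2}/D exchange_big/= -big_split/=; apply: eq_bigr => a _.
  by rewrite -big_split/=; apply: eq_bigr => b _; rewrite opprB.
have : D + D <= \sum_(a in S) \sum_(b in S) 2 * expR (r ^+ 2 / 2).
  rewrite symD; apply: ler_sum => a aS; apply: ler_sum => b bS.
  apply: le_trans (coshR_le _) _.
  rewrite ler_pM2l// ler_expR ler_pM2r ?invr_gt0//.
  have yab := y_osc _ _ aS bS; rewrite -real_normK ?num_real//.
  by rewrite lerXn2r ?nnegrE// (le_trans _ yab).
rewrite !sumr_const -mulrnA -[_ *+ (_ * _)]mulr_natr natrM; lra.
Qed.

End Average.

(** * Uniform n-subsets revealed one element at a time *)

Section Slices.
Variables (T : finType) (n : nat).
Implicit Types (A B : {set T}).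

(** The n-subsets that remain possible once the elements of B are revealed. *)
Definition extensions B : {set {set T}} :=
  [set A : {set T} | (B \subset A) && (#|A| == n)]%SET.

(** Every extension of B is an extension of [a |: B] for exactly n - #|B|
    choices of a outside B. *)
Lemma sum_extensions (R : realType) B (F : {set T} -> R) :
  \sum_(a in (~: B)%SET) \sum_(A in extensions (a |: B)%SET) F A =
  (n - #|B|)%:R * \sum_(A in extensions B) F A.
Proof.
rewrite (exchange_big_dep [in extensions B])/=; last first.
  by move=> a A _; rewrite !inE finset.subUset => /andP[/andP[_ ->] ->].
rewrite mulr_sumr; apply: eq_bigr => A; rewrite inE => /andP[BA /eqP cA].
rewrite (eq_bigl [in A :\: B]%SET); last first.
  by move=> a; rewrite !inE finset.subUset finset.sub1set BA cA eqxx !andbT.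
by rewrite sumr_const cardsD (finset.setIidPr BA) cA mulr_natl.
Qed.

Lemma tperm_setK (a b : T) : involutive (fun A => (tperm a b @: A)%SET).
Proof.
move=> A; rewrite -imset_comp -[RHS]imset_id; apply: eq_imset => x.
by rewrite /= tpermK.
Qed.

(** The coupling of the choices a and b for the next revealed element: the
    transposition of a and b exchanges the two sets of extensions. *)
Lemma tperm_extensions B a b A : a \notin B -> b \notin B ->
  (tperm a b @: A \in extensions (b |: B))%SET =
  (A \in extensions (a |: B))%SET.
Proof.
move=> aB bB; rewrite !inE card_imset; last exact: perm_inj.
congr (_ && _); have -> : (b |: B = tperm a b @: (a |: B))%SET.
  rewrite imsetU1 tpermL; congr (_ |: _)%SET.
  rewrite -[LHS]imset_id; apply: eq_in_imset => x xB.
  rewrite tpermD//; first by apply: contraNneq aB => ->.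
  by apply: contraNneq bB => ->.
have tK (C : {set T}) : (tperm a b @: (tperm a b @: C))%SET = C.
  exact: tperm_setK.
apply/idP/idP => [/(imsetS (tperm a b))|]; last exact: imsetS.
by rewrite !tK.
Qed.

Lemma sum_tperm_extensions (R : realType) B a b (F : {set T} -> R) :
  a \notin B -> b \notin B ->
  \sum_(A in extensions (b |: B)%SET) F A =
  \sum_(A in extensions (a |: B)%SET) F (tperm a b @: A)%SET.
Proof.
move=> aB bB; rewrite (reindex_inj (inv_inj (tperm_setK a b))).
by apply: eq_bigl => A; rewrite tperm_extensions.
Qed.

Lemma card_extensions_tperm (R : realType) B a b : a \notin B -> b \notin B ->
  #|extensions (b |: B)%SET|%:R = #|extensions (a |: B)%SET|%:R :> R.
Proof.
move=> aB bB; have := @sum_tperm_extensions R B a b (fun=> 1) aB bB.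
by rewrite !sumr_const.
Qed.

End Slices.

(** One step of the induction on the exponent. With s = k + d, the difference
    of the two sides is d^2 (s - 1) / (2 s^2 (s + 1)), nonnegative if s >= 1;
    for s = 0 both sides vanish. *)
Lemma variance_step (R : realType) (k d : nat) :
  k%:R * d%:R / (k + d)%:R + (d%:R / (k + d)%:R) ^+ 2 / 2 <=
  k.+1%:R * d%:R / (k.+1 + d)%:R :> R.
Proof.
have [/eqP|kd_gt0] := posnP (k + d)%N.
  rewrite addn_eq0 => /andP[/eqP-> /eqP->].
  by rewrite !(mulr0, mul0r) expr0n/= mul0r addr0.
rewrite addSn -[k.+1%:R]nat1r -[(k + d).+1%:R]nat1r.
have s_ge1 : 1 <= (k + d)%:R :> R by rewrite ler1n.
have -> : k%:R = (k + d)%:R - d%:R :> R by rewrite natrD addrK.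
move: (k + d)%:R s_ge1 => s s_ge1; move: d%:R => e.
have s_neq0 : s != 0 by apply/eqP; lra.
have s1_neq0 : 1 + s != 0 by apply/eqP; lra.
rewrite -subr_ge0.
rewrite (_ : _ - _ = e ^+ 2 * (s - 1) / (2 * s ^+ 2 * (1 + s))); last first.
  by field; rewrite s_neq0 s1_neq0.
have [s_ge0 s1_ge0] : 0 <= s - 1 /\ 0 <= 1 + s by split; lra.
by rewrite divr_ge0// mulr_ge0 ?sqr_ge0// mulr_ge0 ?sqr_ge0.
Qed.

Section SliceConcentration.
Variables (R : realType) (T : finType) (n d : nat).
Hypothesis cardT : #|T| = (n + d)%N.
Implicit Types A B : {set T}.

Local Notation ext := (extensions n).

Lemma card_setC_slice B k : (#|B| + k)%N = n -> #|(~: B)%SET| = (k + d)%N.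
Proof. by move=> Bk; have := cardsC B; rewrite cardT -Bk; lia. Qed.

Lemma card_extensions_step B k a : (#|B| + k)%N = n -> a \notin B ->
  #|ext (a |: B)%SET|%:R * (k + d)%:R = k%:R * #|ext B|%:R :> R.
Proof.
move=> Bk aB; have := sum_extensions n B (fun=> 1 : R).
have -> : (n - #|B|)%N = k by rewrite -Bk addKn.
rewrite sumr_const => <-.
transitivity (\sum_(a' in (~: B)%SET) #|ext (a |: B)%SET|%:R : R).
  by rewrite sumr_const (card_setC_slice Bk) mulr_natr.
apply: eq_bigr => b; rewrite inE => bB.
by rewrite sumr_const (card_extensions_tperm n R bB aB).
Qed.

(** The tower property of conditional expectations. *)
Lemma avg_extensions_tower B k (F : {set T} -> R) : (#|B| + k.+1)%N = n ->
  avg (ext B) F = avg (~: B)%SET (fun a => avg (ext (a |: B)%SET) F).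
Proof.
move=> Bk; have cC := card_setC_slice Bk.
have m_neq0 : (k.+1 + d)%:R != 0 :> R by rewrite pnatr_eq0.
have k_neq0 : k.+1%:R != 0 :> R by rewrite pnatr_eq0.
have step a : a \notin B -> #|ext (a |: B)%SET|%:R =
    k.+1%:R * #|ext B|%:R / (k.+1 + d)%:R :> R.
  by move=> aB; rewrite -(card_extensions_step Bk aB) mulfK.
rewrite [RHS]/avg cC (eq_bigr (fun a => (\sum_(A in ext (a |: B)%SET) F A) *
    (k.+1%:R * #|ext B|%:R / (k.+1 + d)%:R)^-1)); last first.
  by move=> a; rewrite inE => aB; rewrite /avg step.
rewrite -mulr_suml sum_extensions (_ : (n - #|B|)%N = k.+1) ?/avg; last first.
  by rewrite -Bk addKn.
have [->|B_neq0] := eqVneq (#|ext B|%:R : R) 0.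
  by rewrite mulr0 mul0r invr0 !mulr0 mul0r.
by field; rewrite B_neq0 nat1r -natrD k_neq0 m_neq0.
Qed.

Variables (h : {set T} -> R) (c : R).
Hypothesis c_ge0 : 0 <= c.
Hypothesis h_lip : forall A A' : {set T},
  #|A| = n -> #|A'| = n -> (#|A :\: A'| <= 1)%N -> `|h A - h A'| <= c.

(** Under the coupling by the transposition (a b), the extensions of [a |: B]
    containing b are fixed, and those that avoid b change by one exchange. The
    latter form a proportion d / (k + d) of all. *)
Lemma avg_extensions_dist B k a b : (#|B| + k.+1)%N = n ->
  a \notin B -> b \notin B ->
  `|avg (ext (a |: B)%SET) h - avg (ext (b |: B)%SET) h| <=
  c * d%:R / (k + d)%:R.
Proof.
move=> Bk aB bB.
have r_ge0 : 0 <= c * d%:R / (k + d)%:R by rewrite !mulr_ge0 ?invr_ge0.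
have [->|ba] := eqVneq b a; first by rewrite subrr normr0.
have aBk : (#|(a |: B)%SET| + k)%N = n by rewrite cardsU1 aB -Bk addnAC addnC.
have baB : b \notin (a |: B)%SET by rewrite !inE negb_or ba.
have kd_gt0 : (0 < k + d)%N.
  have : (#|b |: (a |: B)|%SET <= #|T|)%N := max_card _.
  by rewrite cardT -aBk cardsU1 baB; lia.
have step := card_extensions_step aBk baB.
set N := #|ext (a |: B)%SET| in step *.
rewrite /avg (card_extensions_tperm n R aB bB) -/N.
rewrite (sum_tperm_extensions n _ aB bB) -mulrBl -sumrB normrM.
have [N0|N_gt0] := posnP N; first by rewrite N0 invr0 normr0 mulr0.
rewrite [X in _ * X]ger0_norm ?invr_ge0// ler_pdivrMr ?ltr0n//.
(* Each extension is charged c if it avoids b and nothing otherwise. *)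
have -> : c * d%:R / (k + d)%:R * N%:R =
    \sum_(A in ext (a |: B)%SET) c * (1 - (b \in A)%:R).
  rewrite -mulr_sumr sumrB sumr_const -/N -natr_sum.
  have -> : (\sum_(A in ext (a |: B)%SET) (b \in A) =
      #|ext (b |: (a |: B))%SET|)%N.
    rewrite -sum1_card [LHS]big_mkcond [RHS]big_mkcond; apply: eq_bigr => A _.
    rewrite !inE [in RHS]finset.subUset finset.sub1set.
    by case: (b \in A) => /=; case: ifP.
  have kd_neq0 : (k + d)%:R != 0 :> R by rewrite pnatr_eq0 -lt0n.
  have -> : #|ext (b |: (a |: B))%SET|%:R = k%:R * N%:R / (k + d)%:R :> R.
    by rewrite -step mulfK.
  by rewrite natrD in kd_neq0 *; field.
apply: le_trans (ler_norm_sum _ _ _) _; apply: ler_sum => A.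
rewrite inE finset.subUset finset.sub1set => /andP[/andP[aA BA] /eqP cA].
have [bA|bA] := boolP (b \in A).
  have -> : (tperm a b @: A)%SET = A.
    apply/eqP; rewrite eqEcard card_imset ?leqnn ?andbT; last exact: perm_inj.
    by apply/fintype.subsetP => _ /imsetP[x xA ->]; case: tpermP => // ->.
  by rewrite !subrr normr0 mulr0.
rewrite subr0 mulr1; apply: h_lip => //.
  by rewrite card_imset//; exact: perm_inj.
rewrite -(cards1 a); apply: subset_leq_card; apply/fintype.subsetP => x.
rewrite !inE => /andP[xN xA]; apply: contraNT xN => xa.
apply/imsetP; exists x => //; rewrite tpermD// 1?eq_sym//.
by apply: contraNneq bA => <-.
Qed.

(** Conditionally on the next element a, the induction hypothesis controls the
    fluctuation of h around its conditional mean; the conditional means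
    themselves fluctuate by the amount of [avg_extensions_dist]. *)
Lemma mgf_extensions B k : (#|B| + k)%N = n ->
  avg (ext B) (fun A => expR (h A - avg (ext B) h)) <=
  expR (c ^+ 2 * (k%:R * d%:R / (k + d)%:R)).
Proof.
elim: k B => [|k IHk] B Bk.
  have -> : ext B = [set B]%SET.
    apply/finset.setP => A; rewrite !inE -Bk addn0.
    apply/andP/eqP => [[BA /eqP cA]|->//].
    by apply/esym/eqP; rewrite eqEcard BA cA leqnn.
  by rewrite !avg_set1 subrr !mul0r mulr0.
pose mu := avg (ext B) h; pose mu_ a := avg (ext (a |: B)%SET) h.
set X := expR (c ^+ 2 * (k%:R * d%:R / (k + d)%:R)).
rewrite (avg_extensions_tower _ Bk).
have tower := avg_extensions_tower h Bk.
have cC := card_setC_slice Bk.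
apply: (@le_trans _ _ (avg (~: B)%SET (fun a => X * expR (mu_ a - mu)))).
  apply: le_avg => a; rewrite inE => aB.
  rewrite (_ : avg _ _ = expR (mu_ a - mu) *
      avg (ext (a |: B)%SET) (fun A => expR (h A - mu_ a))); last first.
    rewrite -avgMl; apply: eq_avg => A _; rewrite -expRD; congr expR.
    by rewrite /mu; ring.
  rewrite mulrC ler_wpM2r ?expR_ge0// IHk// cardsU1 aB -Bk; lia.
rewrite avgMl.
apply: (@le_trans _ _ (X * expR ((c * d%:R / (k + d)%:R) ^+ 2 / 2))).
  rewrite ler_wpM2l ?expR_ge0//; apply: avg_expR_le => [a b|].
    rewrite !inE => aB bB; rewrite opprB addrA subrK.
    exact: avg_extensions_dist Bk aB bB.
  by rewrite avgB_cst ?cC// /mu tower subrr.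
rewrite -expRD ler_expR.
rewrite (_ : _ + _ = c ^+ 2 * (k%:R * d%:R / (k + d)%:R +
    (d%:R / (k + d)%:R) ^+ 2 / 2)).
  by rewrite ler_wpM2l ?sqr_ge0// variance_step.
by rewrite [RHS]mulrDr -(mulrA c) exprMn -(mulrA (c ^+ 2) _ 2^-1).
Qed.

End SliceConcentration.

(** * The tail bound *)

(** Markov's inequality for the exponential of l (h - E h), with l of either
    sign. *)
Lemma slice_tail (R : realType) (T : finType) (n d : nat)
    (h : {set T} -> R) (t : R) :
  #|T| = (n + d)%N -> (0 < n)%N -> 0 <= t ->
  (forall A A' : {set T}, #|A| = n -> #|A'| = n ->
    (#|A :\: A'| <= 1)%N -> `|h A - h A'| <= n%:R^-1) ->
  avg (extensions n finset.set0) (fun A =>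
    (t <= Num.sqrt n%:R * `|h A - avg (extensions n finset.set0) h|)%R%:R) <=
  2 * exp_tail n (n + d) t.
Proof.
move=> cT n_gt0 t_ge0 h_lip; set E := extensions n _; set mu := avg E h.
rewrite /exp_tail; case: ifPn => [/eqP n_nd|n_nd].
  have d0 : d = 0%N by lia.
  have ET : E = [set finset.setT]%SET.
    apply/finset.setP => A; rewrite !inE finset.sub0set eqEcard finset.subsetT.
    by rewrite cardsT cT d0 addn0 /=; have := max_card A; rewrite cT; lia.
  rewrite /mu ET !avg_set1 subrr normr0 mulr0.
  have [->|t_neq0] := eqVneq t 0; first by rewrite lexx mulr1 ler1n.
  by rewrite [t <= 0]leNgt lt_def t_neq0 t_ge0 mulr0.
have d_gt0 : (0 < d)%N by lia.
have n_gt0R : 0 < n%:R :> R by rewrite ltr0n.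
have d_gt0R : 0 < d%:R :> R by rewrite ltr0n.
set r := Num.sqrt n%:R.
have r_gt0 : 0 < r by rewrite sqrtr_gt0.
have r2 : r ^+ 2 = n%:R by rewrite sqr_sqrtr// ltW.
have nd_gt0R : 0 < (n + d)%:R :> R by rewrite ltr0n; lia.
(* l minimizes l^2 d / (n (n + d)) - l t / r, the logarithm of the bound. *)
have [l lE] : {l : R | l = r * (t * (n + d)%:R / (2 * d%:R))} by eexists.
have l_ge0 : 0 <= l.
  by rewrite lE mulr_ge0 ?divr_ge0 ?mulr_ge0// ltW.
pose X := expR (- (t ^+ 2 / (4 * (1 - n%:R / (n + d)%:R)))).
have mgf (e : R) : `|e| = 1 ->
    avg E (fun A => expR (e * l * (h A - mu) - l * t / r)) <= X.
  move=> e1; have c0 : 0 <= l / n%:R by rewrite divr_ge0// ltW.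
  have lip (A A' : {set T}) : #|A| = n -> #|A'| = n -> (#|A :\: A'| <= 1)%N ->
      `|e * l * h A - e * l * h A'| <= l / n%:R.
    move=> cA cA' AA'; rewrite -mulrBr !normrM e1 mul1r (ger0_norm l_ge0).
    by rewrite ler_wpM2l// h_lip.
  have := mgf_extensions cT c0 lip (B := finset.set0) (k := n).
  rewrite cards0 => /(_ erefl); rewrite avgMl -/E -/mu => H.
  rewrite (_ : avg _ _ = expR (- (l * t / r)) *
    avg E (fun A => expR (e * l * h A - e * l * mu))); last first.
    by rewrite -avgMl; apply: eq_avg => A _; rewrite -expRD; congr expR; ring.
  apply: le_trans (ler_wpM2l (expR_ge0 _) H) _.
  rewrite -expRD ler_expR le_eqVlt; apply/orP; left; apply/eqP.
  rewrite -[l * t / r]mulrA lE expr_div_n [(r * _) ^+ 2]exprMn r2.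
  field; rewrite (_ : _ - _ = d%:R); last by ring.
  by rewrite -natrD !gt_eqF.
apply: (@le_trans _ _ (avg E (fun A => expR (1 * l * (h A - mu) - l * t / r)) +
   avg E (fun A => expR (- 1 * l * (h A - mu) - l * t / r)))); last first.
  by rewrite mulr_natl mulr2n lerD// mgf// ?normrN normr1.
rewrite /avg -mulrDl -big_split/= ler_wpM2r ?invr_ge0//.
apply: ler_sum => A _.
have [tA|_] := leP t (r * _); last by rewrite addr_ge0 ?expR_ge0.
have : t / r <= `|h A - mu| by rewrite ler_pdivrMr// mulrC.
rewrite ler_normr => /orP[] H.
  apply: ler_wpDr; rewrite ?expR_ge0// mul1r -expR0 ler_expR.
  by rewrite -mulrA -mulrBr mulr_ge0// subr_ge0.
apply: ler_wpDl; rewrite ?expR_ge0// mulN1r -expR0 ler_expR.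
by rewrite mulNr -mulrN -mulrA -mulrBr mulr_ge0// subr_ge0.
Qed.

(** * From words to sets of positions *)

Definition permute_word (m : nat) (K : finType) (s : {perm 'I_m})
  (w : {ffun 'I_m -> K}) : {ffun 'I_m -> K} := [ffun i => w (s i)].

Lemma permute_wordK (m : nat) (K : finType) (s : {perm 'I_m}) :
  cancel (@permute_word m K s) (permute_word s^-1%g).
Proof. by move=> w; apply/ffunP => i; rewrite !ffunE permKV. Qed.

Lemma word_permP (m : nat) (K : finType) (u v : {ffun 'I_m -> K}) :
  (forall k, #|[set i | u i == k]%SET| = #|[set i | v i == k]%SET|) ->
  exists s : {perm 'I_m}, v = permute_word s u.
Proof.
move=> uv; have : perm_eq [tuple v i | i < m] [tuple u i | i < m].
  apply/allP => k _ /=; rewrite !count_map.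
  have count_card (w : {ffun 'I_m -> K}) :
      count (preim w (pred1 k)) (Finite.enum 'I_m) = #|[set i | w i == k]%SET|.
    rewrite cardE /enum_mem size_filter.
    by apply: eq_count => i; rewrite !inE.
  by rewrite (count_card v) (count_card u) uv.
move=> /tuple_permP[s vs]; exists s; apply/ffunP => i; rewrite ffunE.
have /val_inj/(congr1 (fun z => tnth z i)) := vs.
by rewrite !tnth_mktuple.
Qed.

(** Applied to indicator words, [word_permP] says that the permutations act
    transitively on the sets of a given size. *)
Lemma set_permP (m : nat) (A B : {set 'I_m}) : #|A| = #|B| ->
  exists s : {perm 'I_m}, B = (s @: A)%SET.
Proof.
move=> AB; have [|s /ffunP Bs] :=
  @word_permP m bool [ffun i => i \in A] [ffun i => i \in B].
  have eqT (C : {set 'I_m}) : [set i | [ffun i => i \in C] i == true]%SET = C.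
    by apply/finset.setP => i; rewrite inE ffunE eqb_id.
  have eqF (C : {set 'I_m}) :
      [set i | [ffun i => i \in C] i == false]%SET = (~: C)%SET.
    by apply/finset.setP => i; rewrite !inE ffunE eqbF_neg.
  case; rewrite ?eqT ?eqF//.
  by have := cardsC A; rewrite -(cardsC B) AB => /addnI.
exists s^-1%g; apply/finset.setP => i.
have := Bs i; rewrite !ffunE => ->.
by rewrite -{2}(permK s i) mem_imset//; exact: perm_inj.
Qed.

(** Both sides equal the average of G over all pairs of a word of W and a set of
    size #|A0|. Indeed G is equivariant and the permutations are transitive on
    the words and on the sets, so the average over words is the same for every
    set, and the average over sets is the same for every word. *)
Lemma avg_word_slice (R : realType) (m : nat) (K : finType)
    (W : {set {ffun 'I_m -> K}}) (G : {ffun 'I_m -> K} -> {set 'I_m} -> R)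
    (w0 : {ffun 'I_m -> K}) (A0 : {set 'I_m}) :
  (forall s w, (permute_word s w \in W) = (w \in W)) ->
  (forall w, w \in W -> exists s, w = permute_word s w0) ->
  (forall s w A, G (permute_word s w) A = G w (s @: A)%SET) ->
  w0 \in W ->
  avg W (G^~ A0) = avg (extensions #|A0| finset.set0) (G w0).
Proof.
move=> W_stable W_trans G_eqv w0W; set E := extensions _ _.
have W_gt0 : #|W|%:R != 0 :> R.
  by rewrite pnatr_eq0 -lt0n; apply/card_gt0P; exists w0.
have E_gt0 : #|E|%:R != 0 :> R.
  rewrite pnatr_eq0 -lt0n; apply/card_gt0P; exists A0.
  by rewrite !inE finset.sub0set/=.
pose D := \sum_(w in W) \sum_(A in E) G w A.
have D1 : D = \sum_(A in E) \sum_(w in W) G w A0.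
  rewrite /D exchange_big/=; apply: eq_bigr => A.
  rewrite inE => /andP[_ /eqP cA].
  have [s ->] := set_permP (esym cA).
  rewrite [RHS](reindex_inj (can_inj (permute_wordK s))).
  by apply: eq_big => w; rewrite ?W_stable// G_eqv.
have D2 : D = \sum_(w in W) \sum_(A in E) G w0 A.
  apply: eq_bigr => w /W_trans[s ->].
  rewrite [RHS](reindex_inj (imset_inj (@perm_inj _ s))).
  apply: eq_big => A; last by rewrite G_eqv.
  by rewrite !inE !finset.sub0set card_imset//; exact: perm_inj.
rewrite /avg; apply/eqP; rewrite eqr_div//; apply/eqP.
by move: D1; rewrite D2 !sumr_const !mulr_natr.
Qed.

Lemma sup_range_dist (R : realType) (u v : R -> R) (c : R) :
  has_ubound (range u) -> has_ubound (range v) ->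
  (forall s, `|u s - v s| <= c) -> `|sup (range u) - sup (range v)| <= c.
Proof.
have half (f g : R -> R) : has_ubound (range g) ->
    (forall s, `|f s - g s| <= c) -> sup (range f) - sup (range g) <= c.
  move=> g_ub fg; rewrite lerBlDr; apply: ge_sup; first by exists (f 0), 0.
  move=> _ [s _ <-]; have := fg s; rewrite ler_norml lerBlDr => /andP[_ H].
  by apply: le_trans H _; rewrite lerD2l; apply: ub_le_sup => //; exists s.
move=> u_ub v_ub uv; rewrite ler_norml half// andbT lerNl opprB half// => s.
by rewrite distrC.
Qed.

(** * The supremum deviation as a function of the set of positions *)

Section Deviation.
Variables (R : realType) (m n : nat) (K : finType) (letter : K -> R).
Variable center : R -> R.
Hypothesis center_ge0 : forall s, 0 <= center s.

(** For #|A| = n, the empirical distribution function of the letters at the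
    positions in A. *)
Definition slice_cdf (w : {ffun 'I_m -> K}) (A : {set 'I_m}) (s : R) : R :=
  n%:R^-1 * \sum_(i in A) \1_(`]-oo, s]%classic) (letter (w i)).

Definition slice_deviation w A : R :=
  sup (range (fun s : R => slice_cdf w A s - center s)).

Lemma slice_deviation_permute s w (A : {set 'I_m}) :
  slice_deviation (permute_word s w) A = slice_deviation w (s @: A)%SET.
Proof.
rewrite /slice_deviation (_ : slice_cdf _ A = slice_cdf w (s @: A)%SET) //.
apply/funext => r; congr (_ * _).
rewrite big_imset/=; last by move=> i j _ _; exact: perm_inj.
by apply: eq_bigr => i _; rewrite ffunE.
Qed.

(** The sums over A and A' differ by two sums, each of at most one indicator,
    of opposite signs; the common centering cancels. *)
Lemma slice_deviation_lip w (A A' : {set 'I_m}) :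
  #|A| = n -> #|A'| = n -> (#|A :\: A'| <= 1)%N ->
  `|slice_deviation w A - slice_deviation w A'| <= n%:R^-1.
Proof.
move=> cA cA' AA'.
have A'A : (#|A' :\: A| <= 1)%N.
  by move: AA'; rewrite !cardsD cA cA' finset.setIC.
pose phi s i : R := \1_(`]-oo, s]%classic) (letter (w i)).
have sum_phi s (B : {set 'I_m}) : 0 <= \sum_(i in B) phi s i <= #|B|%:R.
  rewrite sumr_ge0//= -sumr_const ler_sum// => i _.
  by rewrite /phi indicE; case: (_ \in _).
have ub (B : {set 'I_m}) :
    has_ubound (range (fun s => slice_cdf w B s - center s)).
  exists (n%:R^-1 * #|B|%:R) => _ [s _ <-].
  rewrite lerBlDr; apply: ler_wpDr => //.
  by rewrite ler_wpM2l ?invr_ge0//; have /andP[] := sum_phi s B.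
apply: sup_range_dist => // s.
rewrite opprB addrA subrK -mulrBr normrM ger0_norm ?invr_ge0//.
rewrite -[leRHS]mulr1 ler_wpM2l ?invr_ge0//.
rewrite (big_setID A')/= [X in _ - X](big_setID A)/= finset.setIC.
rewrite opprD addrACA subrr add0r.
have /andP[a0 a1] := sum_phi s (A :\: A')%SET.
have /andP[b0 b1] := sum_phi s (A' :\: A)%SET.
have : #|(A :\: A')%SET|%:R <= 1 :> R by rewrite lern1.
have : #|(A' :\: A)%SET|%:R <= 1 :> R by rewrite lern1.
rewrite ler_norml; move: a0 a1 b0 b1; rewrite /phi => *; apply/andP; split; lra.
Qed.

End Deviation.

(** * Averages over the multislice *)

Section MultisliceAverages.
Variables (R : realType) (L : nat) (kappa : 'I_L -> nat) (x : 'I_L -> R).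
Local Notation W := (multislice kappa x).

Lemma multislice_permute s w : (permute_word s w \in W) = (w \in W).
Proof.
rewrite !inE; apply: eq_forallb => l; congr (_ == _).
rewrite -!sum1dep_card [RHS](reindex_inj (@perm_inj _ s)).
by apply: eq_bigl => i; rewrite ffunE.
Qed.

Lemma multislice_trans u w : u \in W -> w \in W ->
  exists s, w = permute_word s u.
Proof.
rewrite !inE => /forallP uW /forallP wW; apply: word_permP => k.
have /codomP[l kl] := valP k.
have letter (v : {ffun 'I_(dimN kappa) -> alphabet x}) :
    [set i | v i == k]%SET = [set i | val (v i) == x l]%SET.
  by apply/finset.setP => i; rewrite !inE -kl.
by rewrite !letter (eqP (uW l)) (eqP (wW l)).
Qed.

Variables (n : nat) (le_nN : (n <= dimN kappa)%N).
Local Notation pr := (proj (x := x) le_nN).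

Lemma prob_kappa_n_avg (P : pred {ffun 'I_n -> alphabet x}) :
  prob_kappa_n le_nN [set v in multislice_n x le_nN | P v]%SET =
  avg W (fun w => (P (pr w))%:R).
Proof.
rewrite /prob_kappa_n /prob_kappa /avg -natr_sum; congr (_%:R / _).
rewrite -sum1_card [LHS]big_mkcond [RHS]big_mkcond; apply: eq_bigr => w _.
rewrite finset.in_setI; case: ifPn => [/andP[wW]|].
  by rewrite wW !inE => /andP[_ ->].
by case: ifP => // wW; rewrite !inE imset_f//= => /negbTE ->.
Qed.

Lemma expect_kappa_n_avg h : expect_kappa_n le_nN h = avg W (fun w => h (pr w)).
Proof.
rewrite /expect_kappa_n /avg /multislice_n (partition_big_imset pr)/= mulr_suml.
apply: eq_bigr => v _.
rewrite /prob_kappa_n /prob_kappa mulrA; congr (_ / _).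
rewrite (eq_bigr (fun=> h v)); last by move=> w /andP[_ /eqP ->].
rewrite sumr_const mulr_natr; congr (_ *+ _); apply: eq_card => w.
by rewrite finset.in_setI; congr (_ && _); rewrite !inE.
Qed.

Lemma empirical_cdf_slice s w :
  empirical_cdf s (pr w) = slice_cdf n (val : alphabet x -> R) w
    [set i : 'I_(dimN kappa) | (i < n)%N]%SET s.
Proof.
congr (_ * _).
rewrite [RHS](eq_bigl (fun i : 'I_(dimN kappa) => (i < n)%N)); last first.
  by move=> i; rewrite inE.
by rewrite (big_ord_narrow le_nN); apply: eq_bigr => i _; rewrite ffunE.
Qed.

Lemma sup_deviation_slice w :
  sup_deviation le_nN (pr w) =
  slice_deviation n (val : alphabet x -> R)
    (fun s => expect_kappa_n le_nN (@empirical_cdf _ _ x n s))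
    w [set i : 'I_(dimN kappa) | (i < n)%N]%SET.
Proof.
by congr sup; congr image; apply/funext => s; rewrite empirical_cdf_slice.
Qed.

End MultisliceAverages.

Theorem corollary1p6 (R : realType) (L : nat) (hL : (2 <= L)%N)
  (kappa : 'I_L -> nat) (hkappa : forall l, (0 < kappa l)%N)
  (x : 'I_L -> R) (hx : injective x)
  (n : nat) (n_gt0 : (1 <= n)%N) (le_nN : (n <= dimN kappa)%N)
  (t : R) (ht : 0 <= t) :
  let f := sup_deviation (x := x) le_nN in
  prob_kappa_n le_nN
    [set w in multislice_n x le_nN |
      t <= Num.sqrt n%:R * `|f w - expect_kappa_n le_nN f|]%SET
  <= 2 * exp_tail n (dimN kappa) t.
Proof.
cbv zeta; set f := sup_deviation le_nN.
rewrite prob_kappa_n_avg expect_kappa_n_avg.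
set W := multislice kappa x.
have [W0|/card_gt0P[w0 w0W]] := posnP #|W|.
  rewrite {1}/avg W0 invr0 mulr0 mulr_ge0// /exp_tail.
  by do 2?case: ifP => //; rewrite expR_ge0.
pose m s := expect_kappa_n le_nN (@empirical_cdf _ _ x n s).
pose A0 : {set 'I_(dimN kappa)} := [set i : 'I_(dimN kappa) | (i < n)%N]%SET.
pose dev := @slice_deviation R (dimN kappa) n _ (val : alphabet x -> R) m.
have cA0 : #|A0| = n.
  by rewrite -sum1dep_card (big_ord_narrow le_nN) sum1_card card_ord.
have transfer (Phi : R -> R) :
    avg W (fun w => Phi (f (proj le_nN w))) =
    avg (extensions n finset.set0) (fun A => Phi (dev w0 A)).
  rewrite -[in RHS]cA0 -(@avg_word_slice _ _ _ W (fun w A => Phi (dev w A))) //.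
  - by apply: eq_avg => w _; rewrite /f sup_deviation_slice.
  - exact: multislice_permute.
  - by move=> w; exact: multislice_trans.
  - by move=> s w A; rewrite /dev slice_deviation_permute.
(* The law of f is transferred twice: in its mean and in the tail event. *)
rewrite (transfer id) (transfer (fun z => (t <= _ * `|z - _|)%R%:R)).
have m_ge0 s : 0 <= m s.
  rewrite /m expect_kappa_n_avg; apply: mulr_ge0; rewrite ?invr_ge0//.
  apply: sumr_ge0 => w _; apply: mulr_ge0; rewrite ?invr_ge0//.
  by apply: sumr_ge0 => i _; rewrite indicE.
have cT : #|'I_(dimN kappa)| = (n + (dimN kappa - n))%N.
  by rewrite card_ord subnKC.
have := slice_tail cT n_gt0 ht (slice_deviation_lip _ m_ge0 w0).
rewrite (subnKC le_nN); exact.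
Qed.
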